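(* Let $d\ge2$ and let the simulation time satisfy $T\not\equiv0\pmod{2\pi}$. There exist constants $c>0$ and $\varepsilon_T>0$, depending only on $T$, such that the following holds. Suppose that an incoherent density matrix exponentiation protocol $\mathcal T$ using $n$ copies achieves error $\varepsilon$ in the diamond norm, i.e., for every density operator $\rho$ on $\mathbb C^d$, $$\left\|\mathcal T(\rho^{\otimes n}\otimes\,\cdot\,)-{}^T\!\!\mathcal A_\rho\right\|_\diamond\le\varepsilon .$$ Then, for $0<\varepsilon\le\varepsilon_T$, $$n\ge c\,\sin^2\!\left(\frac T2\right)\frac d\varepsilon .$$
   Context: Density matrix exponentiation (DME): given $n$ copies of an unknown density operator $\rho$ on $\mathbb C^d$ and a time $T>0$, implement on a data register $\mathbb C^d$ a channel approximating ${}^T\!\!\mathcal A_\rho(\sigma)=e^{-iT\rho}\sigma e^{iT\rho}$. An incoherent protocol is one that measures the input copies and uses only the classical outcome to act on the data register: there is a POVM $\{M_x\}_x$ on $(\mathbb C^d)^{\otimes n}$ and, for each $x$, a channel $\mathcal N_x$ on the data register such that $\mathcal T(\rho^{\otimes n}\otimes\sigma)=\sum_x\operatorname{Tr}(M_x\rho^{\otimes n})\,\mathcal N_x(\sigma)$. $\|\cdot\|_\diamond$ is the diamond norm. *)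

(* Defs.v *)
(* MathComp / MathComp-Analysis; complex numbers are R[i] for R : realType. *)
From HB Require Import structures.
From mathcomp Require Import all_boot all_order all_algebra.
From mathcomp Require Import all_classical all_reals all_analysis.
From mathcomp Require Import sesquilinear spectral complex.
(* The notation ^t of mxtens would clash with the one of sesquilinear. *)
From mathcomp Require Import -(notations) mxtens.

Set Implicit Arguments.
Unset Strict Implicit.
Unset Printing Implicit Defensive.

Import Order.TTheory GRing.Theory Num.Theory.
Import numFieldNormedType.Exports.

Local Open Scope classical_set_scope.
Local Open Scope ring_scope.
Local Open Scope complex_scope.
Local Open Scope sesquilinear_scope.

Notation "A *t B" := (tensmx A B)
  (at level 40, left associativity, format "A  *t  B") : ring_scope.

Section Defs.
Variable R : realType.
Local Notation C := R[i].

Definition psd m (A : 'M[C]_m) : Prop :=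
  A \is hermsymmx /\ forall v : 'cV[C]_m, 0 <= (v^t* *m A *m v) 0 0.

Definition density m (rho : 'M[C]_m) : Prop := psd rho /\ \tr rho = 1.

(* Sum of the exponential series \sum_k A^k / k!, taken entrywise on real and
   imaginary parts. *)
Definition expmx m (A : 'M[C]_m) : 'M[C]_m :=
  \matrix_(i, j)
    (lim (series (fun k : nat => complex.Re ((A ^+ k) i j) / k`!%:R) @ \oo) +i*
     lim (series (fun k : nat => complex.Im ((A ^+ k) i j) / k`!%:R) @ \oo)).

(* Sum of the singular values of A, i.e. trace of the square root of A^* A; its
   (nonnegative) eigenvalues are the entries of spectral_diag. *)
Definition trace_norm m (A : 'M[C]_m) : R :=
  \sum_(i < m) Num.sqrt (complex.Re (spectral_diag (A^t* *m A) 0 i)).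

(* (id_k (x) Phi)(A), where A is cut into k x k blocks of size m x m. *)
Definition ampliation k m m' (Phi : 'M[C]_m -> 'M[C]_m')
    (A : 'M[C]_(k * m)) : 'M[C]_(k * m') :=
  \sum_(i < k) \sum_(j < k) delta_mx i j *t
    Phi (\matrix_(a, b) A (mxtens_index (i, a)) (mxtens_index (j, b))).

(* The supremum is taken in \bar R, so that an unbounded family has norm +oo. *)
Definition diamond_norm m m' (Phi : 'M[C]_m -> 'M[C]_m') : \bar R :=
  ereal_sup [set y | exists k : nat, exists A : 'M[C]_(k * m),
    trace_norm A <= 1 /\ y = (trace_norm (ampliation Phi A))%:E].

Definition completely_positive m m' (Phi : 'M[C]_m -> 'M[C]_m') : Prop :=
  forall (k : nat) (A : 'M[C]_(k * m)), psd A -> psd (ampliation Phi A).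

Definition channel m m' (Phi : {linear 'M[C]_m -> 'M[C]_m'}) : Prop :=
  completely_positive Phi /\ forall A : 'M[C]_m, \tr (Phi A) = \tr A.

Definition povm m (X : finType) (M : X -> 'M[C]_m) : Prop :=
  (forall x, psd (M x)) /\ \sum_x M x = 1%:M.

Definition incoherent_protocol n d
    (P : {linear 'M[C]_(d ^ n * d) -> 'M[C]_d}) : Prop :=
  channel P /\
  exists (X : finType) (M : X -> 'M[C]_(d ^ n))
         (N : X -> {linear 'M[C]_d -> 'M[C]_d}),
    [/\ povm M, forall x, channel (N x) &
      forall rho : 'M[C]_d, density rho -> forall sigma : 'M[C]_d,
        P (ntensmx rho n *t sigma) =
          \sum_x \tr (M x *m ntensmx rho n) *: N x sigma].

(* sigma |-> exp(-i T rho) sigma exp(i T rho) *)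
Definition dme d (T : R) (rho sigma : 'M[C]_d) : 'M[C]_d :=
  expmx ((0 -i* T) *: rho) *m sigma *m expmx ((0 +i* T) *: rho).

End Defs.

(* Main.v *)
Require Import Defs.
From HB Require Import structures.
From mathcomp Require Import all_boot all_order all_algebra.
From mathcomp Require Import all_classical all_reals all_analysis.
From mathcomp Require Import sesquilinear spectral complex.
From mathcomp Require Import -(notations) mxtens.
From mathcomp Require Import ring lra.

(* An Assouad-type argument.  Write d = m + 1, fix a, b with a^2 + m b^2 = 1
   and, for a sign vector s, put psi_s = a e_0 + b sum_j s_j e_j.  On the fixed
   input e_0 the ideal channel for the pure state psi_s outputs the pure state
   V_s, whose e_j-amplitude (exp(-iT) - 1) a b s_j carries the sign s_j.
   Flipping one sign moves the n copies of psi_s by at most 4 n b^2 in squared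
   norm, so when n b^2 is small the measurement cannot tell s from its flip.
   Given the outcome x, the protocol outputs a state sigma_x that does not
   depend on s, and by Lagrange's identity 1 - <V_s|sigma_x|V_s> is at least a
   sum over j of 2x2-minor terms, where the two terms for opposite signs s_j add
   up to at least 2 |exp(-iT) - 1|^2 a^2 b^2 <e_0|sigma_x|e_0>.  Averaging over
   s gives eps >= const sin^2(T/2) m b^2, where m b^2 may be chosen of order
   min(1, m / n). *)

Set Implicit Arguments.
Unset Strict Implicit.
Unset Printing Implicit Defensive.

Import Order.TTheory GRing.Theory Num.Theory.
Local Open Scope ring_scope.

(** * Averaging over sign flips *)

(** Here [p s x] is the probability of outcome [x], [q s j x] the loss in coordinate [j], and [D]
    controls how far a flip moves [p]. Both [p s x] and [p (flip j s) x] are at least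
    [p s x / 2 - D s j x], so a pair of opposite signs loses at least this quantity times
    [2 * B * z x]. Where it is negative the bound is trivial, all losses being nonnegative. *)
Lemma assouad (R : realFieldType) (S J X : finType) (flip : J -> S -> S)
    (p : S -> X -> R) (D : S -> J -> X -> R) (q : S -> J -> X -> R)
    (z : X -> R) (B e : R) :
    (forall j, involutive (flip j)) -> (0 < #|S|)%N -> 0 <= B ->
    (forall x, 0 <= z x <= 1) -> (forall s x, 0 <= p s x) ->
    (forall s j x, 0 <= q s j x) -> (forall s j x, 0 <= D s j x) ->
    (forall s j x, p s x <= 2 * p (flip j s) x + 2 * D s j x) ->
    (forall s j x, 2 * B * z x <= q s j x + q (flip j s) j x) ->
    (forall s j, \sum_x D s j x <= 8^-1) ->
    (forall s, 3 / 4 <= \sum_x p s x * z x) ->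
    (forall s, \sum_x p s x * (\sum_j q s j x) <= e) ->
  #|J|%:R * B <= 4 * e.
Proof.
move=> flipK S0 B0 z01 p0 q0 D0 pD qB sumD sumpz sumpq.
have pair s j : B / 2 <=
    \sum_x (p s x * q s j x + p (flip j s) x * q (flip j s) j x).
  (* The average of [z] is at least 3/4 and the sum of [D] at most 1/8; 3/8 - 1/8 leaves the factor
     1/4. *)
  have -> : B / 2 = 2 * B * ((3 / 4) / 2 - 8^-1) by field.
  have le1 : 2 * B * ((3 / 4) / 2 - 8^-1) <=
      \sum_x 2 * B * (p s x * z x / 2 - D s j x).
    rewrite -mulr_sumr ler_wpM2l ?mulr_ge0 //.
    rewrite sumrB lerB ?sumD // -mulr_suml ler_wpM2r ?invr_ge0 //.
  apply: le_trans le1 _; apply: ler_sum => x _.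
  have /andP[z0 z1] := z01 x.
  have h1 := pD s j x; have h2 := qB s j x.
  have := p0 s x; have := p0 (flip j s) x; have := D0 s j x.
  have := q0 s j x; have := q0 (flip j s) j x.
  move: (p s x) (p (flip j s) x) (q s j x) (q (flip j s) j x) (D s j x) (z x)
    z0 z1 h1 h2 => P P' Q Q' E Z Z0 Z1 h1 h2 Q'0 Q0 E0 P'0 P0.
  (* This uses [Z <= 1] and [0 <= E]. *)
  have le2 : P * Z / 2 - E <= (P / 2 - E) * Z by nra.
  have le3 : 2 * B * (P * Z / 2 - E) <= 2 * B * ((P / 2 - E) * Z).
    by rewrite ler_wpM2l ?mulr_ge0.
  apply: le_trans le3 _.
  have [neg|pos] := lerP (P / 2 - E) 0.
    have : 0 <= P * Q + P' * Q' by rewrite addr_ge0 ?mulr_ge0.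
    by apply: le_trans; rewrite mulr_ge0_le0 ?mulr_ge0 // mulr_le0_ge0.
  have le4 : (P / 2 - E) * (2 * B * Z) <= (P / 2 - E) * (Q + Q').
    by rewrite ler_wpM2l // ltW.
  have : (P / 2 - E) * Q <= P * Q by rewrite ler_wpM2r //; lra.
  have : (P / 2 - E) * Q' <= P' * Q' by rewrite ler_wpM2r //; lra.
  lra.
pose G s j := \sum_x p s x * q s j x.
have sumG s : \sum_j G s j <= e.
  apply: le_trans (sumpq s); rewrite /G exchange_big /=.
  by apply: ler_sum => x _; rewrite mulr_sumr.
(* For fixed [j] the flip permutes the sign vectors, so each term is counted twice. *)
have tot : \sum_s \sum_j (G s j + G (flip j s) j) = 2 * \sum_s \sum_j G s j.
  have -> : 2 * \sum_s \sum_j G s j =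
      \sum_s \sum_j G s j + \sum_j \sum_s G s j.
    by rewrite [X in _ = _ + X]exchange_big /= -mulr2n mulr_natl.
  rewrite exchange_big /= [X in _ = X + _]exchange_big -big_split /=.
  apply: eq_bigr => j _; rewrite big_split /=; congr (_ + _).
  by rewrite [RHS](reindex_inj (inv_inj (flipK j))).
have lo : #|S|%:R * (#|J|%:R * (B / 2)) <=
    \sum_s \sum_j (G s j + G (flip j s) j).
  have -> : #|S|%:R * (#|J|%:R * (B / 2)) = \sum_(s : S) \sum_(j : J) (B / 2).
    by rewrite !sumr_const !mulr_natl.
  apply: ler_sum => s _; apply: ler_sum => j _.
  by rewrite /G -big_split; exact: pair.
have hi : \sum_s \sum_j G s j <= #|S|%:R * e.
  rewrite mulr_natl -sumr_const; exact: ler_sum.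
move: lo; rewrite tot => lo.
have S0' : 0 < #|S|%:R :> R by rewrite ltr0n.
have : #|S|%:R * (#|J|%:R * (B / 2)) <= #|S|%:R * (2 * e) by lra.
rewrite ler_pM2l //; lra.
Qed.

(** * Positive matrices, trace norm and diamond norm *)

Section Matrices.
Local Open Scope complex_scope.
Local Open Scope sesquilinear_scope.
Variable R : realType.
Local Notation C := R[i].
Local Notation Re := complex.Re.

Lemma ReM_ger0 (x y : C) : 0 <= x -> Re (x * y) = Re x * Re y.
Proof. by case: x y => a b [c d] /ger0_Im /= ->; rewrite mul0r subr0. Qed.

Lemma ReB (x y : C) : Re (x - y) = Re x - Re y.
Proof. by case: x y => ? ? []. Qed.

Lemma Re_sum (I : finType) (F : I -> C) : Re (\sum_i F i) = \sum_i Re (F i).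
Proof. by elim/big_rec2: _ => //= i y [u v] _ <-; case: (F i). Qed.

Lemma Re_ge0 (x : C) : 0 <= x -> 0 <= Re x.
Proof. by rewrite lecE => /andP[]. Qed.

Lemma ctrmx_mul m n p (A : 'M[C]_(m, n)) (B : 'M[C]_(n, p)) :
  (A *m B)^t* = B^t* *m A^t*.
Proof. by rewrite trmx_mul map_mxM. Qed.

Lemma hermsymmxP m (A : 'M[C]_m) : reflect (A^t* = A) (A \is hermsymmx).
Proof.
apply: (iffP (is_hermitianmxP _ _ _)); rewrite expr0 scale1r.
  by move=> <-.
by move=> ->.
Qed.

Lemma tr_ctrmx m (A : 'M[C]_m) : \tr (A^t*) = (\tr A)^*.
Proof.
rewrite /mxtrace [RHS](rmorph_sum conjc).
by apply: eq_bigr => i _; rewrite !mxE.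
Qed.

Lemma psd_tr_ge0 m k (M : 'M[C]_m) (W : 'M[C]_(m, k)) :
  psd M -> 0 <= \tr (W^t* *m M *m W).
Proof.
move=> [_ Mpos]; rewrite /mxtrace; apply: sumr_ge0 => j _.
have := Mpos (col j W).
have -> : (col j W)^t* = row j (W^t*) by apply/matrixP => a b; rewrite !mxE.
rewrite -row_mul; congr (_ <= _).
by rewrite [in LHS]mxE [in RHS]mxE; apply: eq_bigr => i _; rewrite !mxE.
Qed.

Lemma psd_diag_ge0 m (A : 'M[C]_m) i : psd A -> 0 <= A i i.
Proof.
move=> [_ /(_ (delta_mx i 0))].
by rewrite trmx_delta map_delta_mx -rowE -colE !mxE.
Qed.

Lemma psd_gram m k (W : 'M[C]_(m, k)) : psd (W *m W^t*).
Proof.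
split; first by apply/hermsymmxP; rewrite ctrmx_mul trmxCK.
move=> v; rewrite mulmxA -mulmxA -[W^t* *m v]trmxCK ctrmx_mul trmxCK.
rewrite mxE; apply: sumr_ge0 => i _.
by rewrite !mxE -normCK exprn_ge0.
Qed.

Lemma tr_gram_ge0 m k (W : 'M[C]_(m, k)) : 0 <= \tr (W^t* *m W).
Proof.
apply: sumr_ge0 => j _; rewrite mxE; apply: sumr_ge0 => i _.
by rewrite !mxE mulrC -normCK exprn_ge0.
Qed.

Lemma psd_spectral m (H : 'M[C]_m) : psd H ->
  exists2 P : 'M[C]_m, P \is unitarymx &
    diag_mx (spectral_diag H) = P *m H *m P^t*.
Proof.
move=> [/hermitian_normalmx/orthomx_spectralP Heq _].
exists (spectralmx H); first exact: spectral_unitarymx.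
have U := spectral_unitarymx H.
rewrite [X in _ *m X *m _]Heq invmx_unitary // !mulmxA (unitarymxP U) mul1mx.
by rewrite -mulmxA (unitarymxP U) mulmx1.
Qed.

(** The quadratic form at the i-th eigenvector, column i of the adjoint of [P], is the i-th
    eigenvalue. *)
Lemma psd_spectral_ge0 m (H : 'M[C]_m) i : psd H -> 0 <= spectral_diag H 0 i.
Proof.
move=> Hpsd; have [P _ Deq] := psd_spectral Hpsd.
have := proj2 Hpsd (P^t* *m delta_mx i 0).
rewrite ctrmx_mul trmxCK -!mulmxA (mulmxA H) (mulmxA P) (mulmxA P) -Deq.
rewrite mulmxA.
have -> : (delta_mx i 0 : 'cV[C]_m)^t* = delta_mx 0 i.
  by rewrite trmx_delta map_delta_mx.
by rewrite -rowE -colE !mxE eqxx mulr1n.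
Qed.

Lemma psd_spectral_tr m (H : 'M[C]_m) : psd H ->
  \tr H = \sum_i spectral_diag H 0 i.
Proof.
move=> /psd_spectral[P U Deq]; rewrite -mxtrace_diag Deq mxtrace_mulC mulmxA.
move: U; rewrite -trmxC_unitary => /unitarymxP; rewrite trmxCK => ->.
by rewrite mul1mx.
Qed.

Lemma trace_norm_ge0 m (A : 'M[C]_m) : 0 <= trace_norm A.
Proof. by apply: sumr_ge0 => i _; exact: sqrtr_ge0. Qed.

Lemma psd_gramC m k (A : 'M[C]_(k, m)) : psd (A^t* *m A).
Proof. by have := psd_gram (A^t*); rewrite trmxCK. Qed.

(** A sum of squares of nonnegative numbers, here the singular values, is at most the square of
    their sum. *)
Lemma frobenius_le_trace_norm m (A : 'M[C]_m) :
  Re (\tr (A^t* *m A)) <= trace_norm A ^+ 2.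
Proof.
have H := psd_gramC A; rewrite psd_spectral_tr // Re_sum expr2 /trace_norm.
rewrite mulr_suml; apply: ler_sum => i _.
have li : 0 <= Re (spectral_diag (A^t* *m A) 0 i).
  by apply: Re_ge0; exact: psd_spectral_ge0.
rewrite -[X in X <= _](sqr_sqrtr li) expr2 ler_wpM2l ?sqrtr_ge0 //.
rewrite (bigD1 i) //= lerDl; apply: sumr_ge0 => j _; exact: sqrtr_ge0.
Qed.

(** The eigenvalues of a projector satisfy x^2 = x, so taking square roots does not change them. *)
Lemma trace_norm_projector m (A : 'M[C]_m) :
  A \is hermsymmx -> A *m A = A -> trace_norm A = Re (\tr A).
Proof.
move=> /hermsymmxP Ah Ai; have H := psd_gramC A.
have HA : A^t* *m A = A by rewrite Ah.
rewrite /trace_norm; move: H; rewrite HA => H.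
rewrite psd_spectral_tr // Re_sum; apply: eq_bigr => i _.
have [P U Deq] := psd_spectral H.
have UP : P^t* *m P = 1%:M.
  by move: U; rewrite -trmxC_unitary => /unitarymxP; rewrite trmxCK.
have idD : diag_mx (spectral_diag A) *m diag_mx (spectral_diag A) =
    diag_mx (spectral_diag A).
  by rewrite Deq -!mulmxA (mulmxA (P^t*)) UP mul1mx (mulmxA A A) Ai.
have li := psd_spectral_ge0 i H.
move: idD => /matrixP/(_ i i); rewrite mulmx_diag !mxE eqxx !mulr1n.
move: li; case: (spectral_diag A 0 i) => a b.
rewrite lecE /= => /andP[/eqP-> a0] [].
by rewrite mul0r subr0 -expr2 => aa _; rewrite -[in LHS]aa sqrtr_sqr ger0_norm.
Qed.

Lemma ctrmx_tens m n p q (A : 'M[C]_(m, n)) (B : 'M[C]_(p, q)) :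
  (A *t B)^t* = A^t* *t B^t*.
Proof. by rewrite trmx_tens map_mxT. Qed.

Lemma tens1_mxE m n (Y : 'M[C]_(m, n)) (i j : 'I_1) a b :
  ((1%:M : 'M[C]_1) *t Y) (mxtens_index (i, a)) (mxtens_index (j, b)) = Y a b.
Proof. by rewrite tensmxE !ord1 mxE mul1r. Qed.

Lemma tr_tensmx m n (A : 'M[C]_m) (B : 'M[C]_n) :
  \tr (A *t B) = \tr A * \tr B.
Proof. by rewrite /mxtrace mulr_sum; apply: eq_bigr => i _; rewrite mxE. Qed.

Lemma ampliation1 m m' (Phi : 'M[C]_m -> 'M[C]_m') (Y : 'M[C]_m) :
  ampliation Phi ((1%:M : 'M[C]_1) *t Y) = (1%:M : 'M[C]_1) *t Phi Y.
Proof.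
rewrite /ampliation !big_ord1; congr (_ *t Phi _).
  by apply/matrixP => i j; rewrite !ord1 !mxE.
by apply/matrixP => a b; rewrite mxE tens1_mxE.
Qed.

(** Complete positivity speaks of tensor products, so it is applied with a one-dimensional ancilla;
    tensoring with the 1 x 1 identity transports matrices between sizes [m] and [1 * m]. *)
Lemma completely_positive_psd m m' (Phi : 'M[C]_m -> 'M[C]_m') (W : 'cV[C]_m) :
  completely_positive Phi -> psd (Phi (W *m W^t*)).
Proof.
move=> cp.
have := cp 1%N ((1%:M : 'M[C]_1) *t (W *m W^t*)); rewrite ampliation1.
have -> : (1%:M : 'M[C]_1) *t (W *m W^t*) =
    ((1%:M : 'M[C]_1) *t W) *m ((1%:M : 'M[C]_1) *t W)^t*.
  by rewrite ctrmx_tens tensmx_mul trmx1 map_mx1 mulmx1.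
move=> /(_ (psd_gram _)) [/hermsymmxP herm pos]; split.
  apply/hermsymmxP/matrixP => a b; rewrite -(tens1_mxE _ 0 0).
  rewrite -[RHS](tens1_mxE _ 0 0) -[in RHS]herm.
  by rewrite ctrmx_tens trmx1 map_mx1.
move=> v.
have pos1 (w : 'cV[C]_(1 * m')) (i j : 'I_1) :
    0 <= (w^t* *m ((1%:M : 'M[C]_1) *t Phi (W *m W^t*)) *m w) i j.
  by rewrite !ord1; exact: pos.
have : 0 <= (((1%:M : 'M[C]_1) *t v)^t* *m
    ((1%:M : 'M[C]_1) *t Phi (W *m W^t*)) *m ((1%:M : 'M[C]_1) *t v))
    (mxtens_index (0, 0)) (mxtens_index (0, 0)) := pos1 _ _ _.
by rewrite ctrmx_tens !tensmx_mul trmx1 map_mx1 !mulmx1 tens1_mxE.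
Qed.

(** The supremum is tested on the pure state of [w] with a trivial ancilla. The Frobenius norm,
    being quadratic, suffices for the expectation bounds that follow. *)
Lemma diamond_norm_frobenius m m' (Phi : 'M[C]_m -> 'M[C]_m') (w : 'cV[C]_m)
    (e : R) :
    \tr (w^t* *m w) = 1 -> 0 <= e -> (diamond_norm Phi <= e%:E)%E ->
  Re (\tr ((Phi (w *m w^t*))^t* *m Phi (w *m w^t*))) <= e ^+ 2.
Proof.
move=> w1 e0 dn; set X := w *m w^t*.
have ww : w^t* *m w = 1%:M.
  by rewrite [LHS]mx11_scalar; move: w1; rewrite /mxtrace big_ord1 => ->.
pose A : 'M[C]_(1 * m) := (1%:M : 'M[C]_1) *t X.
have XX : X *m X = X by rewrite /X mulmxA -(mulmxA w) ww mulmx1.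
have Xh : X^t* = X by apply/hermsymmxP; case: (psd_gram w).
have trA : trace_norm A <= 1.
  rewrite trace_norm_projector.
  - by rewrite tr_tensmx mxtrace1 mul1r /X mxtrace_mulC w1.
  - by apply/hermsymmxP; rewrite ctrmx_tens trmx1 map_mx1 Xh.
  - by rewrite tensmx_mul XX mulmx1.
have : ((trace_norm (ampliation Phi A))%:E <= e%:E)%E.
  apply: le_trans dn; apply: ereal_sup_ubound.
  by exists 1%N, A.
rewrite lee_fin /A ampliation1 => tn.
have := frobenius_le_trace_norm ((1%:M : 'M[C]_1) *t Phi X).
rewrite ctrmx_tens tensmx_mul trmx1 map_mx1 mulmx1 tr_tensmx mxtrace1 mul1r.
move=> /le_trans; apply.
by rewrite ler_sqr ?nnegrE // trace_norm_ge0.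
Qed.

(* Expand 0 <= |B + e v v^*|^2 in the Frobenius norm. *)
Lemma frobenius_expect_ge m (B : 'M[C]_m) (v : 'cV[C]_m) (e : R) :
    \tr (v^t* *m v) = 1 -> 0 < e -> Re (\tr (B^t* *m B)) <= e ^+ 2 ->
  - e <= Re (\tr (v^t* *m B *m v)).
Proof.
move=> v1 e0 Be; set W := v *m v^t*.
have Wh : W^t* = W by apply/hermsymmxP; case: (psd_gram v).
have trW : \tr (W *m W) = 1.
  have vv : v^t* *m v = 1%:M.
    by rewrite [LHS]mx11_scalar; move: v1; rewrite /mxtrace big_ord1 => ->.
  by rewrite /W mulmxA -(mulmxA v) vv mulmx1 mxtrace_mulC.
have -> : v^t* *m B *m v = v^t* *m (B *m v) by rewrite mulmxA.
rewrite mxtrace_mulC -mulmxA -/W.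
have := Re_ge0 (tr_gram_ge0 (B + e%:C *: W)).
have -> : (B + e%:C *: W)^t* = B^t* + e%:C *: W.
  rewrite linearD linearZ /= map_mxD map_mxZ Wh; congr (_ + _ *: _).
  exact: conjc_real.
pose g (X Y : 'M[C]_m) := \tr (X *m Y).
have gDl X Y Z : g (X + Y) Z = g X Z + g Y Z by rewrite /g mulmxDl mxtraceD.
have gDr X Y Z : g Z (X + Y) = g Z X + g Z Y by rewrite /g mulmxDr mxtraceD.
have gZl c X Y : g (c *: X) Y = c * g X Y by rewrite /g -scalemxAl mxtraceZ.
have gZr c X Y : g X (c *: Y) = c * g X Y by rewrite /g -scalemxAr mxtraceZ.
rewrite -/(g _ _) gDl !gDr !gZl !gZr /g trW.
have -> : \tr (B^t* *m W) = (\tr (B *m W))^*.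
  by rewrite -[in LHS]Wh -ctrmx_mul tr_ctrmx mxtrace_mulC.
rewrite (mxtrace_mulC W).
case: (\tr (B *m W)) => x y; move: Be; case: (\tr (B^t* *m B)) => z t /=.
move=> Be; rewrite !(mul0r, subr0, mulr0, addr0, mulr1) => h.
(* The expansion reads |B|^2 + 2 e x + e^2 >= 0, where |B|^2 <= e^2. *)
have : 0 <= 2 * e * (e + x) by nra.
by rewrite pmulr_rge0 ?mulr_gt0 //; lra.
Qed.
End Matrices.

(** * Tensor powers, and the exponential of a real projector *)

Section TensorPowersAndExponential.
Local Open Scope complex_scope.
Local Open Scope sesquilinear_scope.
Import numFieldNormedType.Exports.
Variable R : realType.
Local Notation C := R[i].
Local Notation Re := complex.Re.
Local Notation Im := complex.Im.

Lemma ctrmx_ntens m p (A : 'M[C]_(m, p)) n :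
  (ntensmx A n)^t* = ntensmx (A^t*) n.
Proof.
case: n => [|n]; first by rewrite !ntensmx0 trmx1 map_mx1.
by elim: n => [|n IHn]; rewrite ?ntensmx1 // !ntensmxSS ctrmx_tens IHn.
Qed.

Lemma ntensmx_mul m p q (A : 'M[C]_(m, p)) (B : 'M[C]_(p, q)) n :
  ntensmx A n *m ntensmx B n = ntensmx (A *m B) n.
Proof.
case: n => [|n]; first by rewrite !ntensmx0 mulmx1.
by elim: n => [|n IHn]; rewrite ?ntensmx1 // !ntensmxSS tensmx_mul IHn.
Qed.

Lemma tr_ntensmx m (A : 'M[C]_m) n : \tr (ntensmx A n) = \tr A ^+ n.
Proof.
case: n => [|n]; first by rewrite ntensmx0 expr0 mxtrace1.
by elim: n => [|n IHn]; rewrite ?ntensmx1 // ntensmxSS tr_tensmx IHn -exprS.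
Qed.

Lemma expr_imag_even (t : R) k :
  (0 +i* t) ^+ k.*2 = ((-1) ^+ k * t ^+ k.*2)%:C.
Proof.
rewrite -mul2n exprM (_ : (0 +i* t) ^+ 2 = (- t ^+ 2)%:C).
  rewrite -rmorphXn; congr (_%:C).
  by rewrite [LHS]exprNn -exprM.
by rewrite expr2 /GRing.mul /= expr2 !(mul0r, mulr0, addr0) sub0r.
Qed.

Lemma Re_expr_imag (t : R) k : Re ((0 +i* t) ^+ k) / k`!%:R = cos_coeff t k.
Proof.
rewrite /cos_coeff -[in LHS](odd_double_half k).
case: (boolP (odd k)) => odk /=; rewrite ?add0n ?add1n ?exprS expr_imag_even.
  by rewrite odk /= !(mul0r, mulr0, subr0).
by rewrite (negbTE odk) /= mul1r even_halfK.
Qed.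

Lemma Im_expr_imag (t : R) k : Im ((0 +i* t) ^+ k) / k`!%:R = sin_coeff t k.
Proof.
rewrite /sin_coeff -[in LHS](odd_double_half k).
case: (boolP (odd k)) => odk /=; rewrite ?add0n ?add1n ?exprS expr_imag_even.
  have -> : k.-1./2 = k./2.
    by rewrite -[in LHS](odd_double_half k) odk /= doubleK.
  rewrite odk /= !(mul0r, mul1r, add0r). rewrite mulrCA -exprS.
  by rewrite odd_halfK // prednK // odd_gt0.
by rewrite (negbTE odk) /= !mul0r.
Qed.

(** The zeroth term is split off because the zeroth power of a projector is the identity, while all
    its positive powers are the projector itself. *)
Lemma cvg_series_affine (u v : R^nat) (l x y : R) :
    (series v @ \oo --> l)%classic -> u 0%N = y -> v 0%N = 1 ->
    (forall k, u k.+1 = v k.+1 * x) ->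
  lim (series u @ \oo)%classic = y + (l - 1) * x.
Proof.
move=> vl u0 v0 uv; apply: cvg_lim => //.
have su n : series u n.+1 = y + (series v n.+1 - 1) * x.
  rewrite /series /= !big_nat_recl // u0 v0 addrAC subrr add0r mulr_suml.
  congr (_ + _).
  by apply: eq_bigr => i _.
rewrite -cvg_shiftS. rewrite [X in (X @ _)%classic](_ : _ =
    (fun n => y + (series v n.+1 - 1) * x)); last exact/funext.
apply: cvgD; first exact: cvg_cst.
apply: cvgMr_tmp; apply: cvgB; last exact: cvg_cst.
by move: vl; rewrite -cvg_shiftS.
Qed.

(** All positive powers of [A] equal [A], so the series is 1 + (exp(it) - 1) A. As the entries of
    [A] are real, its real and imaginary parts are the cosine and sine series. *)
Lemma expmx_projector m (A : 'M[C]_m) (t : R) :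
    A *m A = A -> (forall i j, Im (A i j) = 0) ->
  expmx ((0 +i* t) *: A) = 1%:M + ((cos t - 1) +i* sin t) *: A.
Proof.
move=> AA Areal.
have pow k : ((0 +i* t) *: A) ^+ k.+1 = (0 +i* t) ^+ k.+1 *: A.
  elim: k => [|k IHk]; first by rewrite !expr1.
  rewrite exprS IHk [in RHS]exprS.
  by rewrite [LHS]/GRing.mul /= -scalemxAl -scalemxAr AA scalerA.
have coscvg : (series (cos_coeff t) @ \oo --> cos t)%classic.
  by rewrite unlock; exact: is_cvg_series_cos_coeff.
have sincvg : (series (sin_coeff t) @ \oo --> sin t)%classic.
  by rewrite unlock; exact: is_cvg_series_sin_coeff.
apply/matrixP => i j; rewrite !mxE.
have A_ij := Areal i j.
have -> : lim (series (fun k => Re ((((0 +i* t) *: A) ^+ k) i j) / k`!%:R)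
    @ \oo)%classic = (i == j)%:R + (cos t - 1) * Re (A i j).
  apply: (cvg_series_affine coscvg).
  - by rewrite expr0 mxE fact0 divr1; case: (i == j).
  - by rewrite /cos_coeff /= expr0 fact0 divr1 !mulr1.
  - move=> k; rewrite pow mxE -Re_expr_imag.
    case: (A i j) A_ij => a b /= ->; case: (_ ^+ _) => c d /=.
    by rewrite mulr0 subr0 mulrAC.
(* No correction at index 0 is needed here: the identity has imaginary part 0 and [sin_coeff t 0]
   vanishes. *)
have -> : lim (series (fun k => Im ((((0 +i* t) *: A) ^+ k) i j) / k`!%:R)
    @ \oo)%classic = sin t * Re (A i j).
  have -> : (fun k => Im ((((0 +i* t) *: A) ^+ k) i j) / k`!%:R) =
      (fun k => sin_coeff t k * Re (A i j)).
    apply/funext => -[|k].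
      rewrite expr0 mxE /sin_coeff /= !mul0r.
      by case: (i == j) => /=; rewrite mul0r.
    rewrite pow mxE -Im_expr_imag.
    case: (A i j) A_ij => a b /= ->; case: (_ ^+ _) => c d /=.
    by rewrite mulr0 add0r mulrAC.
  apply: cvg_lim => //.
  rewrite [X in (X @ _)%classic](_ : _ =
      fun n => series (sin_coeff t) n * Re (A i j)).
    exact: cvgMr_tmp.
  by apply/funext => n; rewrite /series /= mulr_suml.
case: (A i j) A_ij => a b /= ->; apply/eqP.
by case: (i == j); rewrite eq_complex /=; apply/andP; split; apply/eqP; ring.
Qed.
End TensorPowersAndExponential.

(** * Lagrange's identity for infidelity *)

Section Lagrange.
Local Open Scope complex_scope.
Local Open Scope sesquilinear_scope.
Variable R : realType.
Local Notation C := R[i].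
Local Notation Re := complex.Re.

(* For A = |u><u| the form below is |v_j u_i - v_i u_j|^2. *)
Definition minor_vec m (v : 'cV[C]_m) (i j : 'I_m) : 'cV[C]_m :=
  (v j 0)^*%R *: delta_mx i 0 - (v i 0)^*%R *: delta_mx j 0.

Definition minor_form m (A : 'M[C]_m) (v : 'cV[C]_m) (i j : 'I_m) : C :=
  \tr ((minor_vec v i j)^t* *m A *m minor_vec v i j).

Lemma minor_formE m (A : 'M[C]_m) v i j : minor_form A v i j =
  v j 0 * (v j 0)^*%R * A i i - v j 0 * (v i 0)^*%R * A i j
  - v i 0 * (v j 0)^*%R * A j i + v i 0 * (v i 0)^*%R * A j j.
Proof.
rewrite /minor_form /minor_vec.
have -> : ((v j 0)^*%R *: delta_mx i 0 -
    (v i 0)^*%R *: delta_mx j 0 : 'cV[C]_m)^t* =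
    v j 0 *: delta_mx 0 i - v i 0 *: delta_mx 0 j.
  apply/matrixP => k l; rewrite !mxE rmorphB !rmorphM /= !rmorph_nat.
  by rewrite !conjCK !(andbC (l == _)).
pose g (r : 'rV[C]_m) (c : 'cV[C]_m) := \tr (r *m A *m c).
have gBl r r' c : g (r - r') c = g r c - g r' c.
  by rewrite /g !mulmxBl linearB.
have gBr r c c' : g r (c - c') = g r c - g r c' by rewrite /g mulmxBr linearB.
have gZl x r c : g (x *: r) c = x * g r c by rewrite /g -!scalemxAl mxtraceZ.
have gZr x r c : g r (x *: c) = x * g r c by rewrite /g -scalemxAr mxtraceZ.
have gE k l : g (delta_mx 0 k) (delta_mx l 0) = A k l.
  by rewrite /g -rowE -colE /mxtrace big_ord1 !mxE.
rewrite -/(g _ _) gBl !gBr !gZl !gZr !gE; ring.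
Qed.

Lemma minor_form_ge0 m (A : 'M[C]_m) v i j : psd A -> 0 <= minor_form A v i j.
Proof. exact: psd_tr_ge0. Qed.

Lemma expectE m (A : 'M[C]_m) (v : 'cV[C]_m) :
  \tr (v^t* *m A *m v) = \sum_i \sum_j v j 0 * (v i 0)^*%R * A i j.
Proof.
rewrite /mxtrace big_ord1 mxE exchange_big /=; apply: eq_bigr => j _.
rewrite mxE mulr_suml; apply: eq_bigr => i _.
by rewrite !mxE; ring.
Qed.

Lemma normE m (v : 'cV[C]_m) : \tr (v^t* *m v) = \sum_j v j 0 * (v j 0)^*%R.
Proof.
by rewrite /mxtrace big_ord1 mxE; apply: eq_bigr => j _; rewrite !mxE mulrC.
Qed.

(** Lagrange's identity, extended linearly from rank-one matrices to all [A]; the factor 2 comes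
    from ordered pairs of indices. *)
Lemma sum_minor_form m (A : 'M[C]_m) (v : 'cV[C]_m) :
  \sum_i \sum_j minor_form A v i j =
  2 * (\tr A * \tr (v^t* *m v) - \tr (v^t* *m A *m v)).
Proof.
rewrite expectE normE mulrBr mulr_suml !mulr_sumr.
under eq_bigr do under eq_bigr do rewrite minor_formE.
under eq_bigr do rewrite big_split /= !sumrB.
rewrite big_split /= !sumrB.
rewrite [X in _ - X + _]exchange_big /= [X in _ + X]exchange_big /=.
rewrite [X in _ = X - _](_ : _ =
    2 * \sum_i \sum_j v j 0 * (v j 0)^*%R * A i i); last first.
  rewrite mulr_sumr; apply: eq_bigr => i _; rewrite !mulr_sumr.
  by apply: eq_bigr => j _; ring.
rewrite [X in _ = _ - X](_ : _ =
    2 * \sum_i \sum_j v j 0 * (v i 0)^*%R * A i j); last by rewrite mulr_sumr.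
by ring.
Qed.

(** All terms of Lagrange's identity are nonnegative. Only the pairs {0, j} are kept, and by
    symmetry each occurs twice, which cancels the factor 2. *)
Lemma sum_minor_form_le m (A : 'M[C]_m.+1) (v : 'cV[C]_m.+1) :
    psd A -> \tr A = 1 -> \tr (v^t* *m v) = 1 ->
  \sum_(j < m) Re (minor_form A v ord0 (lift ord0 j)) <=
  1 - Re (\tr (v^t* *m A *m v)).
Proof.
move=> psdA trA v1; have := sum_minor_form A v; rewrite trA v1 mulr1.
move=> /(congr1 (@complex.Re R)) L.
have Q0 i j : 0 <= Re (minor_form A v i j).
  by apply: Re_ge0; exact: minor_form_ge0.
have sym i j : minor_form A v i j = minor_form A v j i.
  by rewrite !minor_formE; ring.
have : 2 * \sum_(j < m) Re (minor_form A v ord0 (lift ord0 j)) <=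
    Re (\sum_i \sum_j minor_form A v i j).
  have -> : Re (\sum_i \sum_j minor_form A v i j) =
      \sum_i \sum_j Re (minor_form A v i j).
    by rewrite Re_sum; apply: eq_bigr => i _; exact: Re_sum.
  rewrite mulr2n mulrDl mul1r [leRHS]big_ord_recl lerD //.
    by rewrite [leRHS]big_ord_recl lerDr.
  apply: ler_sum => i _; rewrite [leRHS]big_ord_recl sym lerDl.
  by apply: sumr_ge0.
rewrite L; case: (\tr (v^t* *m A *m v)) => x y /=; lra.
Qed.

(** The cross terms are odd in [v j 0] and cancel in the sum; the nonnegative terms with [A j j] are
    dropped. *)
Lemma minor_form_flip m (A : 'M[C]_m) (v v' : 'cV[C]_m) i j :
    psd A -> v' i 0 = v i 0 -> v' j 0 = - v j 0 ->
  2 * Re (v j 0 * (v j 0)^*%R) * Re (A i i) <=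
  Re (minor_form A v i j) + Re (minor_form A v' i j).
Proof.
move=> psdA vi vj.
have diag := psd_diag_ge0 _ psdA.
have sqr_ge0 (x : C) : 0 <= x * x^*%R by exact: mulcJ_ge0.
have ReD (x y : C) : Re (x + y) = Re x + Re y by case: x y => ? ? [].
rewrite -ReD !minor_formE vi vj rmorphN /=.
rewrite [X in _ <= Re X](_ : _ = (v j 0 * (v j 0)^*%R * A i i +
    v j 0 * (v j 0)^*%R * A i i) + (v i 0 * (v i 0)^*%R * A j j +
    v i 0 * (v i 0)^*%R * A j j)); last by ring.
rewrite !ReD !(ReM_ger0 _ (sqr_ge0 _)).
have := mulr_ge0 (Re_ge0 (sqr_ge0 (v i 0))) (Re_ge0 (diag j)).
lra.
Qed.
End Lagrange.

(** * The family of pure states indexed by sign vectors *)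

Section Prior.
Local Open Scope complex_scope.
Local Open Scope sesquilinear_scope.
Variables (R : realType) (m : nat).
Local Notation C := R[i].
Local Notation Re := complex.Re.
Local Notation S := {ffun 'I_m -> bool}.

Definition flip (j : 'I_m) (s : S) : S := [ffun k => (k == j) (+) s k].

Lemma flipK j : involutive (flip j).
Proof. by move=> s; apply/ffunP => k; rewrite !ffunE addKb. Qed.

Definition amp (a b : R) (s : S) (i : 'I_m.+1) : R :=
  if unlift ord0 i is Some j then (-1) ^+ s j * b else a.

Lemma amp0 a b s : amp a b s ord0 = a.
Proof. by rewrite /amp unlift_none. Qed.

Lemma amp_lift a b s j : amp a b s (lift ord0 j) = (-1) ^+ s j * b.
Proof. by rewrite /amp liftK. Qed.

Lemma amp_norm a b s : a ^+ 2 + m%:R * b ^+ 2 = 1 ->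
  \sum_i amp a b s i * amp a b s i = 1.
Proof.
move=> ab; rewrite big_ord_recl amp0 -expr2 -[RHS]ab; congr (_ + _).
rewrite (eq_bigr (fun=> b ^+ 2)) ?sumr_const ?card_ord ?mulr_natl // => j _.
by rewrite amp_lift mulrACA -expr2 sqrr_sign mul1r -expr2.
Qed.

(** A flip turns one contribution b^2 to the squared norm into -b^2. *)
Lemma amp_overlap a b s j : a ^+ 2 + m%:R * b ^+ 2 = 1 ->
  \sum_i amp a b s i * amp a b (flip j s) i = 1 - 2 * b ^+ 2.
Proof.
move=> ab; rewrite -[X in X - _](amp_norm s ab) !big_ord_recl !amp0.
rewrite -addrA; congr (_ + _).
rewrite (bigD1 j) //= [in RHS](bigD1 j) //= !amp_lift ffunE eqxx /= signrN.
rewrite (eq_bigr (fun i => amp a b s (lift ord0 i) * amp a b s (lift ord0 i))).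
  have : ((-1) ^+ s j * b) * ((-1) ^+ s j * b) = b ^+ 2.
    by rewrite mulrACA -expr2 sqrr_sign mul1r -expr2.
  rewrite mulrACA; move: (\sum_(i | _) _) ((-1) ^+ s j) => t y h.
  by have -> : b ^+ 2 = y * y * (b * b) by []; ring.
by move=> i ij; rewrite !amp_lift ffunE (negbTE ij).
Qed.

Definition amp_vec a b s : 'cV[C]_m.+1 := \col_i (amp a b s i)%:C.

Lemma amp_vec_dot a b s s' :
  \tr ((amp_vec a b s)^t* *m amp_vec a b s') =
  (\sum_i amp a b s i * amp a b s' i)%:C.
Proof.
rewrite /mxtrace big_ord1 mxE rmorph_sum; apply: eq_bigr => i _.
by rewrite !mxE rmorphM; congr (_ * _); exact: conjc_real.
Qed.

End Prior.

(** * The ideal channel on pure states *)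

Section Rotation.
Local Open Scope complex_scope.
Local Open Scope sesquilinear_scope.
Variable R : realType.
Local Notation C := R[i].
Local Notation Re := complex.Re.
Local Notation Im := complex.Im.

Lemma bernoulli (y : R) n : 0 <= y -> y <= 1 -> 1 - n%:R * y <= (1 - y) ^+ n.
Proof.
move=> y0 y1; elim: n => [|n IHn]; first by rewrite mul0r subr0 expr0.
rewrite exprS; have : (1 - y) * (1 - n%:R * y) <= (1 - y) * (1 - y) ^+ n.
  by rewrite ler_wpM2l // subr_ge0.
apply: le_trans; rewrite -natr1; have : 0 <= n%:R * y * y by rewrite !mulr_ge0.
by lra.
Qed.

(** Parallelogram law for the seminorm of [M]: with w = u - v, |v + w|^2 = 2|v|^2 + 2|w|^2 - |v -
    w|^2. It compares outcome probabilities of two pure states. *)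
Lemma tr_gram_parallelogram m k (M : 'M[C]_m) (u v : 'M[C]_(m, k)) : psd M ->
  Re (\tr (u^t* *m M *m u)) <= 2 * Re (\tr (v^t* *m M *m v)) +
    2 * Re (\tr ((u - v)^t* *m M *m (u - v))).
Proof.
move=> psdM; have := Re_ge0 (psd_tr_ge0 (u - v - v) psdM).
have cB (x y : 'M[C]_(m, k)) : (x - y)^t* = x^t* - y^t*.
  by rewrite linearB /= map_mxB.
pose f (x y : 'M[C]_(m, k)) := \tr (x^t* *m M *m y).
have fBl x y z : f (x - y) z = f x z - f y z.
  by rewrite /f cB !mulmxBl linearB.
have fBr x y z : f z (x - y) = f z x - f z y.
  by rewrite /f mulmxBr linearB.
rewrite -!/(f _ _) !(fBl, fBr).
by move: (f u u) (f u v) (f v u) (f v v) => [? ?] [? ?] [? ?] [? ?] /=; lra.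
Qed.

(* 1 + kappa rho is the unitary exp(-i T rho) when rho is a projector. *)
Definition kappa (T : R) : C := (cos T - 1) -i* sin T.

(** This is |1 + kappa|^2 = 1 expanded, as 1 + kappa = exp(-iT). *)
Lemma kappa_unitary T : kappa T + (kappa T)^* + kappa T * (kappa T)^* = 0.
Proof.
apply/eqP; rewrite eq_complex /=; have := cos2Dsin2 T.
by move=> h; apply/andP; split; apply/eqP; [lra|ring].
Qed.

(** [U] is the exponential of a real projector, and its adjoint is the exponential with the opposite
    sign of [T]; [kappa_unitary] makes [U] preserve norms. *)
Lemma dme_rank1 m (T : R) (v e : 'cV[C]_m)
    (U := 1%:M + kappa T *: (v *m v^t* )) :
    (forall i, Im (v i 0) = 0) -> \tr (v^t* *m v) = 1 ->
  [/\ dme T (v *m v^t*) (e *m e^t*) = (U *m e) *m (U *m e)^t* &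
      \tr ((U *m e)^t* *m (U *m e)) = \tr (e^t* *m e)].
Proof.
move=> vreal v1; set rho := v *m v^t*.
have rr : rho *m rho = rho.
  have vv : v^t* *m v = 1%:M.
    by rewrite [LHS]mx11_scalar; move: v1; rewrite /mxtrace big_ord1 => ->.
  by rewrite /rho mulmxA -(mulmxA v) vv mulmx1.
have rreal i j : Im (rho i j) = 0.
  rewrite mxE big_ord1 !mxE.
  case: (v i 0) (v j 0) (vreal i) (vreal j) => a b [c d] /= -> ->.
  by rewrite oppr0 mulr0 mul0r addr0.
have rh : rho^t* = rho by apply/hermsymmxP; case: (psd_gram v).
have Uc : U^t* = 1%:M + (kappa T)^* *: rho.
  by rewrite linearD linearZ /= map_mxD map_mxZ trmx1 map_mx1 rh.
split.
  rewrite /dme !expmx_projector // ctrmx_mul Uc.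
  rewrite cosN sinN !mulmxA; congr (_ *m (_ + _ *: _)).
  by rewrite /kappa /Num.conj /= opprK.
rewrite ctrmx_mul mulmxA -(mulmxA _ (U^t*) U).
have -> : U^t* *m U = 1%:M; last by rewrite mulmx1.
rewrite Uc /U mulmxDl !mulmxDr !mul1mx !mulmx1 -scalemxAl -scalemxAr rr.
rewrite scalerA -!addrA -!scalerDl.
have -> : kappa T + ((kappa T)^* + (kappa T)^* * kappa T) = 0.
  by rewrite -[RHS](kappa_unitary T) -addrA (mulrC (kappa T)).
by rewrite scale0r addr0.
Qed.

End Rotation.

(** * Lower bound on the error for a fixed pair of amplitudes *)

Section Protocol.
Local Open Scope complex_scope.
Local Open Scope sesquilinear_scope.
Variable R : realType.
Local Notation C := R[i].
Local Notation Re := complex.Re.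

(** Half-angle formula for |exp(-iT) - 1|^2 = 2 - 2 cos T. *)
Lemma kappa_norm (T : R) : kappa T * (kappa T)^*%R = (4 * sin (T / 2) ^+ 2)%:C.
Proof.
have -> : 4 * sin (T / 2) ^+ 2 = 2 - 2 * cos T.
  have {2}-> : T = T / 2 *+ 2 by rewrite -mulr_natr divfK // pnatr_eq0.
  by rewrite cos_mulr2n mulr2n sin2cos2; ring.
apply/eqP; rewrite eq_complex /=; have := cos2Dsin2 T.
by move=> h; apply/andP; split; apply/eqP; [lra|ring].
Qed.

Variables (m n : nat) (P : {linear 'M[C]_(m.+1 ^ n * m.+1) -> 'M[C]_m.+1}).
Variables (T eps a b : R).
Local Notation S := {ffun 'I_m -> bool}.
Hypothesis (ab : a ^+ 2 + m%:R * b ^+ 2 = 1).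

Let e : 'cV[C]_m.+1 := delta_mx ord0 ord0.
Let psi (s : S) : 'cV[C]_m.+1 := amp_vec a b s.
Let rho s := psi s *m (psi s)^t*.
(** The ideal output vector, exp(-i T rho s) applied to [e]. *)
Let V s := (1%:M + kappa T *: rho s) *m e.

Lemma e_ctr : e^t* = delta_mx 0 0.
Proof. by rewrite /e trmx_delta map_delta_mx. Qed.

Lemma psi_norm s : \tr ((psi s)^t* *m psi s) = 1.
Proof. by rewrite amp_vec_dot amp_norm. Qed.

Lemma e_norm : \tr (e^t* *m e) = 1.
Proof. by rewrite e_ctr mul_delta_mx /mxtrace big_ord1 mxE. Qed.

Lemma e_expect (A : 'M[C]_m.+1) : \tr (e^t* *m A *m e) = A 0 0.
Proof. by rewrite e_ctr -rowE -colE /mxtrace big_ord1 !mxE. Qed.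

Lemma VE s i : V s i 0 = (i == 0)%:R + kappa T * (amp a b s i * a)%:C.
Proof.
rewrite /V -colE !mxE.
congr (_ + _ * _); rewrite big_ord1 !mxE amp0 rmorphM; congr (_ * _).
exact: conjc_real.
Qed.

Lemma V_flip_head s j : V (flip j s) ord0 0 = V s ord0 0.
Proof.
apply: etrans (VE _ _) _; apply: etrans (esym (VE _ _)).
by rewrite !amp0.
Qed.

Lemma V_flip_tail s j : V (flip j s) (lift ord0 j) 0 = - V s (lift ord0 j) 0.
Proof.
apply: etrans (VE _ _) _; apply: etrans (esym (congr1 -%R (VE _ _))).
rewrite !amp_lift ffunE eqxx /= signrN !add0r.
by rewrite !(mulNr, rmorphN, mulrN).
Qed.

Lemma rho_density s : density (rho s).
Proof. by split; [exact: psd_gram | rewrite mxtrace_mulC psi_norm]. Qed.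

Lemma V_dme s : dme T (rho s) (e *m e^t*) = V s *m (V s)^t* /\
  \tr ((V s)^t* *m V s) = 1.
Proof.
have [] := @dme_rank1 R m.+1 T (psi s) e.
- by move=> i; rewrite mxE.
- exact: psi_norm.
by move=> -> ->; rewrite e_norm.
Qed.

Lemma V_tail s j : V s (lift ord0 j) 0 * (V s (lift ord0 j) 0)^*%R =
  (4 * sin (T / 2) ^+ 2 * (a ^+ 2 * b ^+ 2))%:C.
Proof.
rewrite VE /= add0r [Num.conj _]rmorphM /= mulrACA kappa_norm.
rewrite (_ : Num.conj _ = (amp a b s (lift ord0 j) * a)%:C);
  last exact: conjc_real.
rewrite -!rmorphM /= amp_lift; congr (_%:C).
have h : (-1) ^+ s j * (-1) ^+ s j = 1 :> R by rewrite -expr2 sqrr_sign.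
move: ((-1) ^+ s j) h => y h.
have -> : y * b * a * (y * b * a) = (y * y) * (a ^+ 2 * b ^+ 2) by ring.
by rewrite h mul1r.
Qed.

(** [V s] is a unit vector whose tail has total weight 4 sin^2(T/2) a^2 m b^2, at most 4 m b^2. *)
Lemma V_head s : 1 - 4 * (m%:R * b ^+ 2) <= Re (V s 0 0 * (V s 0 0)^*%R).
Proof.
have [_] := V_dme s; rewrite normE big_ord_recl => /(congr1 (@complex.Re R)).
rewrite (eq_bigr _ (fun j _ => V_tail s j)) sumr_const card_ord -rmorphMn.
move: (V s ord0 0 * _) => [x y] /=.
move=> h; have {h} -> : x = 1 - 4 * sin (T / 2) ^+ 2 * (a ^+ 2 * b ^+ 2) *+ m.
  by apply/esym/eqP; rewrite subr_eq h.
have s1 : sin (T / 2) ^+ 2 <= 1 by rewrite sin2cos2 gerBl sqr_ge0.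
have mb0 : 0 <= m%:R * b ^+ 2 by rewrite mulr_ge0 ?sqr_ge0.
have a1 : a ^+ 2 <= 1 by rewrite -ab lerDl.
have := sqr_ge0 (sin (T / 2)); have := sqr_ge0 a.
have -> : 4 * sin (T / 2) ^+ 2 * (a ^+ 2 * b ^+ 2) *+ m =
    4 * ((m%:R * b ^+ 2) * (sin (T / 2) ^+ 2 * a ^+ 2)).
  by rewrite -[LHS]mulr_natl; ring.
move: (a ^+ 2) (sin _ ^+ 2) (m%:R * _) mb0 a1 s1 => A S B B0 A1 S1 A0 S0.
have : B * (S * A) <= B * 1 by rewrite ler_wpM2l // mulr_ile1.
lra.
Qed.

(** The squared distance is 2 - 2 (1 - 2 b^2)^n, which Bernoulli's inequality bounds by 4 n b^2. *)
Lemma psi_overlap s j :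
  2 * n%:R * b ^+ 2 <= 1 / 16 ->
  Re (\tr ((ntensmx (psi s) n - ntensmx (psi (flip j s)) n)^t* *m
           (ntensmx (psi s) n - ntensmx (psi (flip j s)) n))) <= 8^-1.
Proof.
move=> small.
pose g (x y : 'M[C]_(m.+1 ^ n, 1 ^ n)) := \tr (x^t* *m y).
have gBl x y z : g (x - y) z = g x z - g y z.
  by rewrite /g linearB /= map_mxB mulmxBl linearB.
have gBr x y z : g z (x - y) = g z x - g z y by rewrite /g mulmxBr linearB.
have gE s1 s2 : g (ntensmx (psi s1) n) (ntensmx (psi s2) n) =
    ((\sum_i amp a b s1 i * amp a b s2 i) ^+ n)%:C.
  by rewrite /g ctrmx_ntens ntensmx_mul tr_ntensmx amp_vec_dot -rmorphXn.
rewrite -/(g _ _) gBl !gBr !gE.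
have sym : \sum_i amp a b (flip j s) i * amp a b s i = 1 - 2 * b ^+ 2.
  by rewrite -(amp_overlap s j ab); apply: eq_bigr => i _; rewrite mulrC.
rewrite sym amp_overlap // !amp_norm // !expr1n /=.
have b0 := sqr_ge0 b.
(* For n = 0 smallness says nothing about [b], but the distance is 0; for n >= 1 it yields the
   condition 2 b^2 <= 1 of [bernoulli]. *)
have [->|n0] := posnP n; first by rewrite !expr0; lra.
have n1 : 1 <= n%:R :> R by rewrite ler1n.
have : 1 - n%:R * (2 * b ^+ 2) <= (1 - 2 * b ^+ 2) ^+ n.
  apply: bernoulli; first by lra.
  have : b ^+ 2 <= n%:R * b ^+ 2 by rewrite ler_peMl.
  lra.
lra.
Qed.

Lemma incoherent_error_ge : 0 < eps -> eps <= 8^-1 -> m%:R * b ^+ 2 <= 32^-1 ->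
    2 * n%:R * b ^+ 2 <= 1 / 16 -> incoherent_protocol P ->
    (forall r : 'M[C]_m.+1, density r ->
      (diamond_norm (fun sigma : 'M[C]_m.+1 =>
        (P (ntensmx r n *t sigma) - dme T r sigma)%R) <= eps%:E)%E) ->
  m%:R * b ^+ 2 * sin (T / 2) ^+ 2 <= 2 * eps.
Proof.
move=> eps0 eps8 mb nb [_ [X [M [N [[Mpsd Msum] Nch PE]]]]] Perr.
pose sigma x := N x (e *m e^t*).
have sigma_psd x : psd (sigma x).
  by have [cp _] := Nch x; exact: completely_positive_psd.
have sigma_tr x : \tr (sigma x) = 1.
  by have [_ ->] := Nch x; rewrite mxtrace_mulC e_norm.
pose W s := ntensmx (psi s) n.
have trMW s x : \tr (M x *m ntensmx (rho s) n) = \tr ((W s)^t* *m M x *m W s).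
  by rewrite /rho -ntensmx_mul -ctrmx_ntens mulmxA mxtrace_mulC mulmxA.
pose p s x := Re (\tr (M x *m ntensmx (rho s) n)).
have tr_ge0 s x : 0 <= \tr (M x *m ntensmx (rho s) n).
  by rewrite trMW; exact: psd_tr_ge0.
have p1 s : \sum_x p s x = 1.
  rewrite /p -Re_sum -(raddf_sum (@mxtrace _ _)) -mulmx_suml Msum mul1mx /=.
  by rewrite tr_ntensmx mxtrace_mulC psi_norm expr1n.
(* The error is tested on the input [e] and the output measured along [v]. This serves for [v = e],
   bounding the weight [z], and for [v = V s], bounding the infidelity. *)
have out_expect s (v : 'cV[C]_m.+1) : \tr (v^t* *m v) = 1 ->
    - eps <= \sum_x p s x * Re (\tr (v^t* *m sigma x *m v)) -
      Re (\tr (v^t* *m (V s *m (V s)^t*) *m v)).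
  move=> v1.
  have := diamond_norm_frobenius e_norm (ltW eps0) (Perr _ (rho_density s)).
  rewrite PE //; last exact: rho_density.
  have [-> _] := V_dme s.
  move=> /(frobenius_expect_ge v1 eps0) /le_trans; apply.
  rewrite mulmxBr mulmxBl (raddfB (@mxtrace _ _)).
  rewrite mulmx_sumr mulmx_suml (raddf_sum (@mxtrace _ _)).
  rewrite [leLHS]ReB Re_sum lerD2r.
  apply: ler_sum => x _.
  by rewrite -scalemxAr -scalemxAl /= mxtraceZ ReM_ger0.
pose q s j x := Re (minor_form (sigma x) (V s) ord0 (lift ord0 j)).
pose z x := Re (sigma x 0 0).
have sigma_diag x i := psd_diag_ge0 i (sigma_psd x).
have z01 x : 0 <= z x <= 1.
  apply/andP; split; first exact: Re_ge0.
  have -> : 1 = Re (\tr (sigma x)) by rewrite sigma_tr.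
  rewrite /mxtrace Re_sum big_ord_recl lerDl.
  by apply: sumr_ge0 => i _; exact: Re_ge0.
pose D s j x :=
  Re (\tr ((W s - W (flip j s))^t* *m M x *m (W s - W (flip j s)))).
pose B := 4 * sin (T / 2) ^+ 2 * (a ^+ 2 * b ^+ 2).
have : #|'I_m|%:R * B <= 4 * eps.
  apply: (@assouad R S 'I_m X (@flip m) p D q z B eps (@flipK m)) => //.
  - by apply/card_gt0P; exists [ffun=> false].
  - by apply: mulr_ge0; apply: mulr_ge0; rewrite ?sqr_ge0.
  - by move=> s x; exact: Re_ge0.
  - by move=> s j x; apply: Re_ge0; exact: minor_form_ge0.
  - by move=> s j x; apply: Re_ge0; exact: psd_tr_ge0.
  - by move=> s j x; rewrite /p !trMW; exact: tr_gram_parallelogram.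
  - move=> s j x; have := @minor_form_flip R m.+1 (sigma x) (V s)
      (V (flip j s)) ord0 (lift ord0 j) (sigma_psd x).
    rewrite V_tail; apply.
      exact: V_flip_head.
    exact: V_flip_tail.
  (* The POVM sums to the identity, so summing [D] over outcomes gives the squared distance of the
     tensor powers. *)
  - move=> s j; rewrite /D -Re_sum -(raddf_sum (@mxtrace _ _)) -mulmx_suml.
    by rewrite -mulmx_sumr Msum mulmx1 /=; exact: psi_overlap.
  (* The head weight of [V s] is at least 1 - 4/32 = 7/8, and the error costs at most 1/8, leaving
     3/4. *)
  - move=> s; have := out_expect s e e_norm.
    rewrite e_expect.
    have -> : (V s *m (V s)^t*) 0 0 = V s 0 0 * (V s 0 0)^*%R.
      by rewrite mxE big_ord1 !mxE.
    have := V_head s.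
    under eq_bigr do rewrite e_expect.
    rewrite -/(\sum_x p s x * z x); lra.
  (* The ideal output has fidelity 1 with [V s], so the mean infidelity is at most [eps]; by
     Lagrange's identity it dominates the summed losses. *)
  - move=> s; have [_ V1] := V_dme s.
    have := out_expect s (V s) V1.
    have -> : \tr ((V s)^t* *m (V s *m (V s)^t*) *m V s) = 1.
      have VV : (V s)^t* *m V s = 1%:M.
        by rewrite [LHS]mx11_scalar; move: V1; rewrite /mxtrace big_ord1 => ->.
      by rewrite (mulmxA _ (V s) ((V s)^t*)) VV mul1mx VV mxtrace1.
    move=> h.
    have : \sum_x p s x * (\sum_j q s j x) <=
        \sum_x p s x * (1 - Re (\tr ((V s)^t* *m sigma x *m V s))).
      apply: ler_sum => x _; apply: ler_wpM2l; first exact: Re_ge0.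
      exact: sum_minor_form_le.
    under [X in _ <= X]eq_bigr do rewrite mulrBr mulr1.
    rewrite sumrB p1 /= => /le_trans; apply.
    by move: h; rewrite /=; lra.
rewrite card_ord /B => h.
have a1 : 2^-1 <= a ^+ 2 by move: ab mb; lra.
have y0 : 0 <= m%:R * b ^+ 2 * sin (T / 2) ^+ 2.
  by apply: mulr_ge0; rewrite ?sqr_ge0 // mulr_ge0 ?sqr_ge0.
move: h; rewrite (_ : _ * (_ * _) =
  4 * a ^+ 2 * (m%:R * b ^+ 2 * sin (T / 2) ^+ 2)); last by ring.
move: (_ * sin _ ^+ 2) y0 => y y0 h.
have : 2 * y <= 4 * a ^+ 2 * y by rewrite ler_wpM2r //; lra.
lra.
Qed.
End Protocol.

(** * Zeros of the sine, and the choice of amplitudes *)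

(** Subtracting the largest multiple of pi below [x] leaves a zero of the sine in [0, pi), which
    must be 0. *)
Lemma sin_eq0_int (R : realType) (x : R) : 0 <= x -> sin x = 0 ->
  exists k : nat, x = k%:R * pi.
Proof.
move=> x0 sx; have pi0 : 0 < pi :> R := pi_gt0 R.
have /andP[lo hi] := truncn_itv (divr_ge0 x0 (ltW pi0)).
set k := Num.truncn _ in lo hi; exists k.
move: lo hi; rewrite ler_pdivlMr // ltr_pdivrMr // -natr1 mulrDl mul1r => lo hi.
pose y := x - k%:R * pi.
have y0 : 0 <= y by rewrite subr_ge0.
have ypi : y < pi by rewrite /y; lra.
have sy : sin y = 0.
  have : sin (y + pi *+ k) = 0.
    by rewrite -mulr_natl /y subrK.
  rewrite (alternatingn (@sinDpi R)) => /eqP.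
  by rewrite mulf_eq0 signr_eq0 => /eqP.
move: y0; rewrite le_eqVlt => /orP[/eqP y0|y0]; first by rewrite /y in y0; lra.
by have := sin_gt0_pi (x := y); rewrite sy ltxx y0 ypi => /(_ isT).
Qed.

Theorem theoremS5p3 (R : realType) (T : R) (hT : 0 < T)
  (hTmod : forall k : int, T <> k%:~R * (2 * pi)) :
  exists c epsT : R, [/\ 0 < c, 0 < epsT &
    forall (d n : nat) (P : {linear 'M[R[i]]_(d ^ n * d) -> 'M[R[i]]_d})
           (eps : R),
      (2 <= d)%N ->
      incoherent_protocol P ->
      (forall rho : 'M[R[i]]_d, density rho ->
        (diamond_norm (fun sigma : 'M[R[i]]_d =>
           (P (ntensmx rho n *t sigma) - dme T rho sigma)%R) <= eps%:E)%E) ->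
      0 < eps -> eps <= epsT ->
      c * sin (T / 2) ^+ 2 * (d%:R / eps) <= n%:R].
Proof.
set s2 := sin (T / 2) ^+ 2.
have s2_gt0 : 0 < s2.
  (* If sin(T/2) vanished, T/2 would be a multiple of pi, contrary to [hTmod]. *)
  rewrite lt_neqAle sqr_ge0 andbT eq_sym sqrf_eq0; apply/eqP => sT0.
  have [k kT] := sin_eq0_int (divr_ge0 (ltW hT) (ler0n R 2)) sT0.
  apply: (hTmod k); rewrite -pmulrn mulrCA -kT mulrC divfK //.
have s2_le1 : s2 <= 1 by rewrite /s2 sin2cos2 gerBl sqr_ge0.
(* The main case gives m s2 <= 64 n eps, and d <= 2 m doubles 64 to 128. The bound on [eps] excludes
   n < m, where s2 <= 64 eps would follow. *)
exists (1 / 128), (s2 / 128); split; [lra|lra|].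
move=> [//|m] n P eps m_gt0 prot err eps0 epsle.
have m0 : 0 < m%:R :> R by rewrite ltr0n.
(* [delta] stands for m b^2, realised by b = sqrt(delta / m) and a = sqrt(1 - delta); the third
   condition is 2 n b^2 <= 1/16 rewritten. *)
have bound delta : 0 <= delta -> delta <= 32^-1 -> 32 * n%:R * delta <= m%:R ->
    delta * s2 <= 2 * eps.
  move=> d0 d1 nd.
  have b2 : Num.sqrt (delta / m%:R) ^+ 2 = delta / m%:R.
    by rewrite sqr_sqrtr // divr_ge0 // ltW.
  have mb : m%:R * Num.sqrt (delta / m%:R) ^+ 2 = delta.
    by rewrite b2 mulrC divfK // gt_eqF.
  rewrite -[X in X * _]mb.
  apply: (incoherent_error_ge (P := P) (a := Num.sqrt (1 - delta))) => //;
    last first.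
  - rewrite b2 mulrA ler_pdivrMr //; lra.
  - by rewrite mb.
  - lra.
  - by rewrite mb sqr_sqrtr ?subrK // subr_ge0; lra.
rewrite mulrA ler_pdivrMr //.
have d2m : m.+1%:R <= 2 * m%:R :> R.
  by rewrite -natrM ler_nat mul2n -addnn -addn1 leq_add2l.
have sd : s2 * m.+1%:R <= s2 * (2 * m%:R) by rewrite ler_pM2l.
(* With few copies delta = 1/32 is admissible and contradicts the bound on [eps]; otherwise delta =
   m / (32 n), the largest value allowed. *)
have [nm|mn] := ltnP n m.
  have nm' : n%:R <= m%:R :> R by rewrite ler_nat ltnW.
  have : 32^-1 * s2 <= 2 * eps by apply: bound => //; lra.
  lra.
have n0 : 0 < n%:R :> R by rewrite ltr0n (leq_trans _ mn).
have mn' : m%:R <= n%:R :> R by rewrite ler_nat.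
have : m%:R / (32 * n%:R) * s2 <= 2 * eps.
  apply: bound.
  - by rewrite divr_ge0 // ltW // mulr_gt0.
  - rewrite ler_pdivrMr ?mulr_gt0 //; lra.
  - by rewrite mulrC divfK ?lexx // gt_eqF // mulr_gt0.
rewrite mulrAC ler_pdivrMr ?mulr_gt0 //; lra.
Qed.
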